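(* Let $(X,d)$ be a cone metric space and let $r\in E$ with $0\ll r$ or $r=0$. Let $\{x_{n_k}\}$ be a subsequence of a sequence $\{x_n\}$ in $X$. Then $LIM^{r}x_n\subset LIM^{r}x_{n_k}$.
   Context: Let $E$ be a real Banach space. A subset $P\subset E$ is a cone if (i) $P$ is closed, nonempty and $P\neq\{0\}$; (ii) $a,b\in\mathbb{R}$, $a,b\ge 0$, $x,y\in P$ implies $ax+by\in P$; (iii) $x\in P$ and $-x\in P$ implies $x=0$. Write $x\le y$ if $y-x\in P$, $x<y$ if $x\le y$ and $x\ne y$, and $x\ll y$ if $y-x\in \mathrm{int}\,P$ (the interior of $P$). A cone metric space $(X,d)$ (associated with $E$ and $P$) is a nonempty set $X$ with a map $d:X\times X\to E$ such that for all $x,y,z\in X$: $0\le d(x,y)$, and $d(x,y)=0$ iff $x=y$; $d(x,y)=d(y,x)$; $d(x,y)\le d(x,z)+d(z,y)$. For $r\in E$ with $0\ll r$ or $r=0$, a sequence $\{x_n\}$ in $X$ is $r$-convergent to $x\in X$ if for every $\epsilon\in E$ with $0\ll\epsilon$ there is $k\in\mathbb{N}$ such that $d(x_n,x)\ll r+\epsilon$ for all $n\ge k$. The $r$-limit set is $LIM^{r}x_n=\{x\in X: \{x_n\}\text{ is } r\text{-convergent to } x\}$. *)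

(* Defs.v *)
From HB Require Import structures.
From mathcomp Require Import all_boot all_order all_algebra.
From mathcomp Require Import all_classical all_reals all_analysis.
Set Implicit Arguments.
Unset Strict Implicit.
Unset Printing Implicit Defensive.
Import Order.TTheory GRing.Theory Num.Theory.
Import numFieldNormedType.Exports.
Local Open Scope classical_set_scope.
Local Open Scope ring_scope.

Record is_cone (R : realType) (E : completeNormedModType R) (P : set E) : Prop :=
  IsCone {
    cone_closed : closed P;
    cone_nonempty : P !=set0;
    cone_neq0 : P <> [set 0];
    cone_comb : forall (a b : R) (x y : E),
      0 <= a -> 0 <= b -> P x -> P y -> P (a *: x + b *: y);
    cone_pointed : forall x : E, P x -> P (- x) -> x = 0
  }.

Definition cone_le (R : realType) (E : completeNormedModType R) (P : set E)
  (x y : E) : Prop := P (y - x).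

Definition cone_ll (R : realType) (E : completeNormedModType R) (P : set E)
  (x y : E) : Prop := interior P (y - x).

Record is_cone_metric (R : realType) (E : completeNormedModType R) (P : set E)
  (X : Type) (d : X -> X -> E) : Prop :=
  IsConeMetric {
    cone_metric_inhabited : inhabited X;
    cone_metric_ge0 : forall x y : X, cone_le P 0 (d x y);
    cone_metric_eq0 : forall x y : X, d x y = 0 <-> x = y;
    cone_metric_sym : forall x y : X, d x y = d y x;
    cone_metric_triangle : forall x y z : X,
      cone_le P (d x y) (d x z + d z y)
  }.

Definition r_convergent (R : realType) (E : completeNormedModType R)
  (P : set E) (X : Type) (d : X -> X -> E) (r : E) (u : nat -> X) (x : X) : Prop :=
  forall eps : E, cone_ll P 0 eps ->
    exists k : nat, forall n : nat, (k <= n)%N ->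
      cone_ll P (d (u n) x) (r + eps).

Definition LIM (R : realType) (E : completeNormedModType R)
  (P : set E) (X : Type) (d : X -> X -> E) (r : E) (u : nat -> X) : set X :=
  [set x | r_convergent P d r u x].

(* Main.v *)
Require Import Defs.
From HB Require Import structures.
From mathcomp Require Import all_boot all_order all_algebra.
From mathcomp Require Import all_classical all_reals all_analysis.
Import Order.TTheory GRing.Theory Num.Theory.
Import numFieldNormedType.Exports.
Local Open Scope classical_set_scope.
Local Open Scope ring_scope.

(** A strictly increasing [phi] never falls below the identity, so every tail of the subsequence
    lies in the corresponding tail of the sequence. Any bound that holds eventually for [x] thus
    holds for [x \o phi] from the same index on. *)

Lemma leq_extractor (phi : nat -> nat)
  (hphi : forall i j : nat, (i < j)%N -> (phi i < phi j)%N) (n : nat) :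
  (n <= phi n)%N.
Proof.
elim: n => [//|n IHn].
(* The chain [n <= phi n < phi n.+1] yields [n < phi n.+1], which is by definition
   [n.+1 <= phi n.+1]. *)
exact: leq_ltn_trans IHn (hphi _ _ (ltnSn n)).
Qed.

Theorem theorem3p9 (R : realType) (E : completeNormedModType R) (P : set E)
  (hP : is_cone P) (X : Type) (d : X -> X -> E) (hd : is_cone_metric P d)
  (r : E) (hr : cone_ll P 0 r \/ r = 0)
  (x : nat -> X) (phi : nat -> nat)
  (hphi : forall i j : nat, (i < j)%N -> (phi i < phi j)%N) :
  LIM P d r x `<=` LIM P d r (fun k : nat => x (phi k)).
Proof.
move=> y xy eps eps_gt0; have [k xk] := xy eps eps_gt0.
(* The threshold [k] of the full sequence is reused, since [k <= n <= phi n]. *)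
exists k => n kn; apply: xk.
exact: leq_trans kn (leq_extractor _ hphi n).
Qed.
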